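(* Let $K$ be a field, $S=K[x_1,\ldots,x_n]$, $I\subset S$ a monomial ideal generated in degree $d$, and $B=G(I)$ its minimal set of monomial generators. Let $<^{\#}$ be a monomial order on $R=K[\{T_u\}_{u\in B}]$ and $<_\sigma$ a monomial order on $S$. If $B$ satisfies the $\sigma$-exchange property with respect to $<^{\#}$, then $I$ is of fiber type.
   Context: For a monomial $w$ of $S$, $\nu_i(w)$ is the exponent of $x_i$ in $w$ and $\operatorname{supp}(w)=\{i:\nu_i(w)>0\}$. $K[B]\subset S$ is the $K$-subalgebra generated by the monomials in $B$, and the toric ideal $J_{K[B]}$ is the kernel of the $K$-algebra map $R\to K[B]$, $T_u\mapsto u$. A monomial of $R$ is a standard monomial of $J_{K[B]}$ with respect to $<^{\#}$ if it does not belong to the initial ideal $\mathrm{in}_{<^{\#}}(J_{K[B]})$. $B$ satisfies the $\sigma$-exchange property with respect to $<^{\#}$ if: whenever $T_{u_1}\cdots T_{u_N}$ and $T_{v_1}\cdots T_{v_N}$ are standard monomials of $J_{K[B]}$ with respect to $<^{\#}$ such that $u_1\cdots u_N<_\sigma v_1\cdots v_N$, there exist $1\le\delta\le N$, $q\in\operatorname{supp}(v_1\cdots v_N)$ and $j\in\operatorname{supp}(u_\delta)$ such that (i) $\nu_q(u_1\cdots u_N)<\nu_q(v_1\cdots v_N)$; (ii) $x_j<_\sigma x_q$; (iii) $x_qu_\delta/x_j\in B$. Let $\mathcal T=K[x_1,\ldots,x_n,T_u: u\in B]$, let $\mathcal R(I)=\bigoplus_{j\ge 0}I^jt^j\subset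 S[t]$ be the Rees algebra, and let $P_{\mathcal R(I)}$ be the kernel of the $K$-algebra map $\mathcal T\to\mathcal R(I)$, $x_i\mapsto x_i$, $T_u\mapsto ut$. The ideal $I$ is of fiber type if the relations of the symmetric algebra of $I$ (the elements of $P_{\mathcal R(I)}$ that are homogeneous of degree $1$ in the variables $T_u$) together with the fiber relations (the elements of $J_{K[B]}=P_{\mathcal R(I)}\cap R$) generate $P_{\mathcal R(I)}$. *)

(* Defs.v *)
From HB Require Import structures.
From mathcomp Require Import all_boot all_order all_algebra.
From mathcomp Require Export mpoly.

Set Implicit Arguments.
Unset Strict Implicit.
Unset Printing Implicit Defensive.

Import GRing.Theory.
Local Open Scope ring_scope.

Definition ideal_span (A : comNzRingType) (G : A -> Prop) (p : A) : Prop :=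
  exists2 s : seq (A * A),
    (forall c, c \in s -> G c.2) & p = \sum_(c <- s) c.1 * c.2.

Definition generated_by_monomials (K : fieldType) (n : nat)
    (I : {mpoly K[n]} -> Prop) (M : 'X_{1..n} -> Prop) : Prop :=
  forall p, I p <-> ideal_span (fun g => exists2 w, M w & g = 'X_[w]) p.

Definition monomial_ideal_in_degree (K : fieldType) (n d : nat)
    (I : {mpoly K[n]} -> Prop) : Prop :=
  exists2 M : 'X_{1..n} -> Prop,
    (forall w, M w -> mdeg w = d) & generated_by_monomials I M.

(* [B] lists, without repetition, the minimal generating set G(I).  The order
   of the list only fixes which variable of R = {mpoly K[m]} is T_u:
   T_u is 'X_i for u = tnth B i. *)
Definition minimal_monomial_generators (K : fieldType) (n m : nat)
    (I : {mpoly K[n]} -> Prop) (B : m.-tuple 'X_{1..n}) : Prop :=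
  [/\ uniq B,
      generated_by_monomials I (fun w => w \in B)
    & forall C : seq 'X_{1..n}, {subset C <= B} ->
        generated_by_monomials I (fun w => w \in C) -> {subset B <= C}].

(* A strict total order on monomials, with 1 (written 0%MM) smallest. *)
Definition monomial_order (n : nat) (lt : rel 'X_{1..n}) : Prop :=
  [/\ irreflexive lt,
      transitive lt,
      forall v w, v != w -> lt v w || lt w v,
      forall w, w != 0%MM -> lt 0%MM w
    & forall u v w, lt v w -> lt (u + v)%MM (u + w)%MM].

Definition initial_monomial (K : fieldType) (n : nat) (lt : rel 'X_{1..n})
    (f : {mpoly K[n]}) (w : 'X_{1..n}) : Prop :=
  w \in msupp f /\ forall v, v \in msupp f -> v != w -> lt v w.

Definition initial_ideal (K : fieldType) (n : nat) (lt : rel 'X_{1..n})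
    (J : {mpoly K[n]} -> Prop) : {mpoly K[n]} -> Prop :=
  ideal_span (fun g =>
    exists f w, [/\ J f, initial_monomial lt f w & g = 'X_[w]]).

Definition standard_monomial (K : fieldType) (n : nat) (lt : rel 'X_{1..n})
    (J : {mpoly K[n]} -> Prop) (w : 'X_{1..n}) : Prop :=
  ~ initial_ideal lt J 'X_[w].

(* T_u |-> u.  The codomain is S instead of its subalgebra K[B], which does
   not affect the kernel. *)
Definition toric_map (K : fieldType) (n m : nat) (B : m.-tuple 'X_{1..n})
    (f : {mpoly K[m]}) : {mpoly K[n]} :=
  mmap (@mpolyC n K) (fun i => 'X_[tnth B i]) f.

Definition toric_ideal (K : fieldType) (n m : nat) (B : m.-tuple 'X_{1..n})
    (f : {mpoly K[m]}) : Prop :=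
  toric_map B f = 0.

Definition mon_supp (n : nat) (w : 'X_{1..n}) : {set 'I_n} :=
  [set i | (0 < w i)%N].

(* The monomial T_{u_1} ... T_{u_N} of R is given by the indices of the u_k
   in [B]; [tmon a] is its exponent and [smon B a] that of u_1 ... u_N. *)
Definition tmon (m N : nat) (a : 'I_N -> 'I_m) : 'X_{1..m} :=
  (\sum_(k < N) U_(a k))%MM.

Definition smon (n m N : nat) (B : m.-tuple 'X_{1..n}) (a : 'I_N -> 'I_m) :
    'X_{1..n} :=
  (\sum_(k < N) tnth B (a k))%MM.

Definition sigma_exchange (K : fieldType) (n m : nat)
    (B : m.-tuple 'X_{1..n})
    (lt_sharp : rel 'X_{1..m}) (lt_sigma : rel 'X_{1..n}) : Prop :=
  forall (N : nat) (u v : 'I_N -> 'I_m),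
    standard_monomial lt_sharp (@toric_ideal K n m B) (tmon u) ->
    standard_monomial lt_sharp (@toric_ideal K n m B) (tmon v) ->
    lt_sigma (smon B u) (smon B v) ->
    exists (delta : 'I_N) (q j : 'I_n),
      [/\ q \in mon_supp (smon B v),
          j \in mon_supp (tnth B (u delta)),
          (smon B u q < smon B v q)%N,
          lt_sigma U_(j)%MM U_(q)%MM
        & (U_(q) + tnth B (u delta) - U_(j))%MM \in B].

(* K[x_1, ..., x_n, T_u : u in B] is {mpoly K[n + m]}, the first n variables
   being the x_i.  The Rees algebra is a subring of S[t] = {poly {mpoly K[n]}}
   ('X in the last branch is t), and the map is taken with values in S[t]. *)
Definition rees_map (K : fieldType) (n m : nat) (B : m.-tuple 'X_{1..n})
    (f : {mpoly K[n + m]}) : {poly {mpoly K[n]}} :=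
  mmap (fun c : K => (c%:MP_[n])%:P)
       (fun k => match split k with
                 | inl i => ('X_i)%:P
                 | inr i => ('X_[tnth B i])%:P * 'X
                 end) f.

Definition rees_ideal (K : fieldType) (n m : nat) (B : m.-tuple 'X_{1..n})
    (f : {mpoly K[n + m]}) : Prop :=
  rees_map B f = 0.

Definition T_degree (n m : nat) (w : 'X_{1..n + m}) : nat :=
  (\sum_(i < m) w (rshift n i))%N.

Definition symmetric_relation (K : fieldType) (n m : nat)
    (B : m.-tuple 'X_{1..n}) (f : {mpoly K[n + m]}) : Prop :=
  rees_ideal B f /\ forall w, w \in msupp f -> T_degree w = 1%N.

Definition T_inclusion (K : fieldType) (n m : nat) (g : {mpoly K[m]}) :
    {mpoly K[n + m]} :=
  mmap (@mpolyC (n + m) K) (fun i => 'X_(rshift n i)) g.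

(* The fiber relations are the elements of P_{R(I)} inside R.  They are the
   elements of the toric ideal as soon as d > 0; for d = 0 and I = S the toric
   ideal contains T_1 - 1, which is not a relation of the Rees algebra. *)
Definition fiber_relation (K : fieldType) (n m : nat)
    (B : m.-tuple 'X_{1..n}) (f : {mpoly K[n + m]}) : Prop :=
  rees_ideal B f /\ exists g : {mpoly K[m]}, f = T_inclusion n g.

Definition fiber_type (K : fieldType) (n m : nat) (B : m.-tuple 'X_{1..n}) :
    Prop :=
  forall f : {mpoly K[n + m]},
    rees_ideal B f <->
    ideal_span (fun g => symmetric_relation B g \/ fiber_relation B g) f.

(* Main.v *)
(** The Rees ideal is spanned by the binomials x^a T^al - x^b T^be whose two
    terms have the same image, so it suffices to show that such terms are
    congruent modulo the linear and the fiber relations.  Fiber relations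
    replace T^al and T^be by standard monomials of the same T-degree.  If their
    images in S agree, so do the terms.  Otherwise the image of, say, T^al is
    smaller for <_sigma, and the exchange property gives
    x_q u_delta = x_j u' with u' in B; the q-th exponents force x_q to divide
    x^a, so the linear relation x_q T_(u_delta) - x_j T_(u') applies to
    x^a T^al.  As x_j <_sigma x_q, this increases the smaller of the two
    images, which has a fixed degree, and the process stops. *)
Require Import Defs.
From mathcomp Require Import all_boot all_order all_algebra zify.

Set Implicit Arguments.
Unset Strict Implicit.
Unset Printing Implicit Defensive.

Import GRing.Theory.
Local Open Scope ring_scope.

(** * Congruence modulo the ideal spanned by a predicate *)

Section IdealSpan.
Variables (A : comNzRingType) (G : A -> Prop).
Implicit Types p q r : A.

Lemma ideal_span0 : ideal_span G 0.
Proof. by exists [::]; rewrite ?big_nil. Qed.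

Lemma ideal_span_gen p : G p -> ideal_span G p.
Proof.
move=> Gp; exists [:: (1, p)]; last by rewrite big_seq1 mul1r.
by move=> c; rewrite inE => /eqP ->.
Qed.

Lemma ideal_spanD p q :
  ideal_span G p -> ideal_span G q -> ideal_span G (p + q).
Proof.
move=> [s Gs ->] [t Gt ->]; exists (s ++ t); last by rewrite big_cat.
by move=> c; rewrite mem_cat => /orP[/Gs|/Gt].
Qed.

Lemma ideal_spanMl r p : ideal_span G p -> ideal_span G (r * p).
Proof.
move=> [s Gs ->]; exists [seq (r * c.1, c.2) | c <- s].
  by move=> c /mapP[e /Gs ? ->].
by rewrite big_map mulr_sumr; apply: eq_bigr => c _; rewrite mulrA.
Qed.

Lemma ideal_spanBC p q : ideal_span G (p - q) -> ideal_span G (q - p).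
Proof. by move/(ideal_spanMl (-1)); rewrite mulN1r opprB. Qed.

Lemma ideal_spanB_trans p q r :
  ideal_span G (p - q) -> ideal_span G (q - r) -> ideal_span G (p - r).
Proof. by move=> pq /(ideal_spanD pq); rewrite addrA subrK. Qed.

Lemma ideal_span_kernel (A' : comNzRingType) (f : {rmorphism A -> A'}) p :
  (forall g, G g -> f g = 0) -> ideal_span G p -> f p = 0.
Proof.
move=> G0 [s Gs ->]; rewrite raddf_sum big_seq big1 // => c /Gs/G0 /= c0.
by rewrite rmorphM /= c0 mulr0.
Qed.

End IdealSpan.

Lemma ideal_span_sub (A : comNzRingType) (G H : A -> Prop) p :
  (forall g, G g -> ideal_span H g) -> ideal_span G p -> ideal_span H p.
Proof.
move=> GH [s Gs ->]; rewrite big_seq.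
elim/big_ind: _ => [||c /Gs/GH]; first exact: ideal_span0.
  exact: ideal_spanD.
exact: ideal_spanMl.
Qed.

(** * Supports, cancellation of terms, and induction in a fixed degree *)

Lemma monomial_span_dvd (K : fieldType) n (G : {mpoly K[n]} -> Prop) p w :
  (forall g, G g -> exists v, g = 'X_[v]) -> ideal_span G p -> w \in msupp p ->
  exists2 v, G 'X_[v] & (v <= w)%MM.
Proof.
(* A term of the sum comes from one of the products r X^v, and every term of such a product is a
   multiple of X^v. *)
move=> GX [s Gs ->] /msupp_sum_le /flattenP[t /mapP[c]].
rewrite filter_predT => /Gs Gc -> {t}; have [v cv] := GX _ Gc.
rewrite cv (perm_mem (msuppMX _ _)) => /mapP[u _ ->].
by exists v; rewrite -?cv // lem_addr.
Qed.

(** Otherwise the sum would reduce to the nonzero [c w]. Applied to the coefficients of a polynomial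
    in a kernel, with [P] selecting the terms that have a given image. *)
Lemma cancelling_term (R : nzRingType) (T : eqType) (s : seq T) (c : T -> R)
    (P : pred T) w :
  uniq s -> w \in s -> P w -> c w != 0 -> \sum_(v <- s) c v * (P v)%:R = 0 ->
  exists v, [/\ v \in s, v != w & P v].
Proof.
move=> us ws Pw cw s0.
have [/hasP[v vs /andP[vw Pv]]|no] := boolP (has [pred v | (v != w) && P v] s).
  by exists v.
case/negP: cw; rewrite -s0 (bigD1_seq w) //= Pw mulr1.
rewrite big_seq_cond big1 ?addr0 //.
move=> v /andP[vs vw]; move/hasPn: no => /(_ v vs) /=; rewrite vw /=.
by move/negPf => ->; rewrite mulr0.
Qed.

(** Only finitely many monomials have degree at most [N], so the number of those below [w] is a
    decreasing measure. It is used for a monomial order and for the reverse of one. *)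
Lemma mdeg_eq_wf_ind n (lt : rel 'X_{1..n}) N (P : 'X_{1..n} -> Prop) :
  irreflexive lt -> transitive lt ->
  (forall w, mdeg w = N ->
     (forall v, mdeg v = N -> lt v w -> P v) -> P w) ->
  forall w, mdeg w = N -> P w.
Proof.
move=> irr tr IH w; pose S u := [set v : 'X_{1..n < N.+1} | lt v u].
have [k le_k] := ubnP #|S w|; elim: k w le_k => // k IHk w le_k dw.
apply: IH => // v dv vw; apply: IHk => //.
rewrite -ltnS; apply: leq_trans le_k; rewrite ltnS.
apply: proper_card; apply/properP; split.
  by apply/subsetP => x; rewrite !inE => /tr; apply.
have dvN : (mdeg v < N.+1)%N by rewrite dv.
by exists (BMultinom dvN); rewrite !inE ?irr.
Qed.

Lemma lepm_mdeg_eq n (v w : 'X_{1..n}) :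
  (v <= w)%MM -> mdeg v = mdeg w -> v = w.
Proof.
move=> vw; rewrite -[in mdeg w](submK vw) mdegD -[LHS]add0n => /addIn/esym/eqP.
by rewrite mdeg_eq0 => /eqP e; rewrite -(submK vw) e add0m.
Qed.

(** * The toric map and its standard monomials *)

Section ToricMap.
Variables (K : fieldType) (n m : nat) (B : m.-tuple 'X_{1..n}).

(** Exponent of the image of T^al under T_u |-> u. *)
Definition bmon (al : 'X_{1..m}) : 'X_{1..n} :=
  (\sum_(i < m) tnth B i *+ al i)%MM.

Lemma bmonE al k : bmon al k = (\sum_(i < m) tnth B i k * al i)%N.
Proof. by rewrite mnm_sumE; apply: eq_bigr => i _; rewrite mulmnE. Qed.

Lemma bmonD al be : bmon (al + be)%MM = (bmon al + bmon be)%MM.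
Proof.
apply/mnmP => k; rewrite mnmDE !bmonE -big_split; apply: eq_bigr => i _ /=.
by rewrite mnmDE mulnDr.
Qed.

Lemma bmon0 : bmon 0%MM = 0%MM.
Proof.
apply/mnmP => k; rewrite bmonE big1 ?mnm0E // => i _.
by rewrite mnm0E muln0.
Qed.

Lemma bmonU i : bmon U_(i)%MM = tnth B i.
Proof.
apply/mnmP => k; rewrite bmonE (bigD1 i) //= mnm1E eqxx muln1 big1 ?addn0 //.
by move=> j ji; rewrite mnm1E eq_sym (negPf ji) muln0.
Qed.

Lemma mdeg_bmon d al :
  (forall w, w \in B -> mdeg w = d) -> mdeg (bmon al) = (d * mdeg al)%N.
Proof.
move=> dB; rewrite mdeg_sum mdegE big_distrr; apply: eq_bigr => i _ /=.
by rewrite mdegMn dB ?mem_tnth.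
Qed.

Lemma bmon_tmon N (a : 'I_N -> 'I_m) : bmon (tmon a) = smon B a.
Proof.
rewrite /tmon /smon (big_morph _ bmonD bmon0).
by apply: eq_bigr => k _; rewrite bmonU.
Qed.

(** Passes from exponents to the indexed families of the exchange property, splitting off one
    variable at a time. *)
Lemma tmonP N al : mdeg al = N -> exists a : 'I_N -> 'I_m, tmon a = al.
Proof.
elim: N al => [|N IH] al dal.
  move/eqP: dal; rewrite mdeg_eq0 => /eqP ->.
  exists (fun k : 'I_0 => match notF (ltn_ord k) with end).
  by rewrite /tmon big_ord0.
have [i ali] : exists i, (al i != 0)%N.
  apply/existsP; apply: contra_eqT dal => /existsPn al0.
  by rewrite mdegE big1 // => i _; apply/eqP/negPn.
have le_i : (U_(i) <= al)%MM by rewrite lep1mP.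
have [|a a_al] := IH (al - U_(i))%MM.
  by apply: (@addIn 1%N); rewrite -{1}(mdeg1 i) -mdegD submK // dal addn1.
exists (fun k => oapp a i (unlift ord0 k)).
rewrite /tmon big_ord_recl unlift_none /= addmC -[RHS](submK le_i) -a_al.
by congr (_ + _)%MM; apply: eq_bigr => k _; rewrite liftK.
Qed.

Lemma toric_mapX al : toric_map B 'X_[al] = 'X_[bmon al] :> {mpoly K[n]}.
Proof.
rewrite /toric_map mmapX /mmap1 /bmon.
rewrite (big_morph _ (@mpolyXD _ _) (mpolyX0 _ _)).
by apply: eq_bigr => i _; rewrite mpolyXn.
Qed.

Lemma toric_ideal_binomial al be :
  bmon al = bmon be -> toric_ideal B ('X_[al] - 'X_[be] : {mpoly K[m]}).
Proof.
move=> e; rewrite /toric_ideal {1}/toric_map raddfB /= -!/(toric_map _ _).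
by rewrite !toric_mapX e subrr.
Qed.

(** The coefficient of the zero image at [bmon w] collects the coefficients of [f] at all terms with
    that image, so the one at [w] must be cancelled by another. *)
Lemma toric_ideal_cancel (f : {mpoly K[m]}) w :
  toric_ideal B f -> w \in msupp f ->
  exists v, [/\ v \in msupp f, v != w & bmon v = bmon w].
Proof.
move=> f0 wf; have c_w : f@_w != 0 by rewrite -mcoeff_msupp.
have sum0 : \sum_(v <- msupp f) f@_v * (bmon v == bmon w)%:R = 0.
  rewrite -[RHS](mcoeff0 K (bmon w)) -f0 /toric_map /mmap raddf_sum.
  apply: eq_bigr => v _; rewrite /= mcoeffCM -(mcoeffX K); congr (_ * _@__).
  by rewrite -toric_mapX /toric_map mmapX.
have [v [vf vw /eqP bv]] := cancelling_term
    (P := fun v => bmon v == bmon w) (msupp_uniq f) wf (eqxx _) c_w sum0.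
by exists v.
Qed.

(** A smallest monomial for [lt] among those with the given degree and image is standard. *)
Lemma standard_exists lt d al :
  monomial_order lt -> (0 < d)%N -> (forall w, w \in B -> mdeg w = d) ->
  exists be, [/\ standard_monomial lt (@toric_ideal K n m B) be,
    mdeg be = mdeg al & bmon be = bmon al].
Proof.
move=> [irr tr _ _ ltD] d0 dB; have [N dal] : exists N, mdeg al = N by eexists.
move: al dal; apply: (mdeg_eq_wf_ind irr tr) => al dal IH.
have [/existsP[be /and3P[/eqP dbe lbe /eqP bbe]]|no] :=
    boolP [exists be : 'X_{1..m < N.+1},
      [&& mdeg be == N, lt be al & bmon be == bmon al]].
  have [ga [sga dga bga]] := IH _ dbe lbe.
  by exists ga; split; rewrite ?bga ?dga ?dbe.
exists al; split=> // in_al.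
have al_supp : al \in msupp ('X_[al] : {mpoly K[m]}) by rewrite msuppX inE.
have [g|v [f [w [Jf [wf wmax] vw]]] le_v] := monomial_span_dvd _ in_al al_supp.
  by move=> [f [w [_ _ ->]]]; exists w.
have : v \in msupp ('X_[w] : {mpoly K[m]}) by rewrite -vw msuppX inE.
rewrite msuppX inE => /eqP {}vw.
(* Some other term [u] of [f] has the image of the initial monomial dividing T^al; substituting it
   gives a smaller monomial with the image of T^al. *)
have [u [uf uw bu]] := toric_ideal_cancel Jf wf.
pose be := (al - v + u)%MM.
have bbe : bmon be = bmon al by rewrite bmonD bu -vw -bmonD submK.
(* The image has degree [d] times the T-degree, so for positive [d] it determines the T-degree. *)
have dbe : mdeg be = N.
  by apply/eqP; rewrite -dal -(eqn_pmul2l d0) -!(mdeg_bmon _ dB) bbe.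
have be_lt : (mdeg be < N.+1)%N by rewrite dbe.
case/existsP: no; exists (BMultinom be_lt) => /=.
rewrite dbe bbe !eqxx andbT /=.
by rewrite -[X in lt _ X](submK le_v); apply: ltD; rewrite vw; apply: wmax.
Qed.

(** T^al - T^be lies in the toric ideal and has initial monomial T^al. *)
Lemma standard_minimal (lt : rel 'X_{1..m}) al be :
  irreflexive lt -> bmon al = bmon be -> lt be al ->
  ~ standard_monomial lt (@toric_ideal K n m B) al.
Proof.
move=> irr e lt_be; apply; apply: ideal_span_gen.
have ne : be != al by apply: contraTneq lt_be => ->; rewrite irr.
exists ('X_[al] - 'X_[be]), al; split=> //; first exact: toric_ideal_binomial.
split=> [|v /msuppB_le].
  by rewrite mcoeff_msupp mcoeffB !mcoeffX eqxx (negPf ne) subr0 oner_eq0.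
by rewrite mem_cat !msuppX !inE => /orP[] /eqP -> //; rewrite eqxx.
Qed.

Lemma standard_unique lt al be :
  monomial_order lt ->
  standard_monomial lt (@toric_ideal K n m B) al ->
  standard_monomial lt (@toric_ideal K n m B) be ->
  bmon al = bmon be -> al = be.
Proof.
move=> [irr _ tot _ _] sal sbe e; have [//|ne] := eqVneq al be.
case/orP: (tot _ _ ne) => [lt_al|lt_be].
  by case: (standard_minimal irr (esym e) lt_al sbe).
by case: (standard_minimal irr e lt_be sal).
Qed.

End ToricMap.

(** * Degree of the minimal generators *)

Lemma minimal_generators_mdeg (K : fieldType) n d m (I : {mpoly K[n]} -> Prop)
    (B : m.-tuple 'X_{1..n}) :
  monomial_ideal_in_degree d I -> minimal_monomial_generators I B ->
  forall w, w \in B -> mdeg w = d.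
Proof.
move=> [M dM MI] [_ BI minB] w.
have spanX (N : 'X_{1..n} -> Prop) (p : {mpoly K[n]}) :
    (exists2 w, N w & p = 'X_[w]) -> exists v, p = 'X_[v].
  by move=> [v _ ->]; exists v.
have dvd_gen N v : generated_by_monomials I N -> I 'X_[v] ->
    exists2 u, N u & (u <= v)%MM.
  have vv : v \in msupp ('X_[v] : {mpoly K[n]}) by rewrite msuppX inE.
  move=> NI /(NI _).1 Iv.
  have [u [u' Nu' uu'] le_u] := monomial_span_dvd (@spanX N) Iv vv.
  have : u \in msupp ('X_[u'] : {mpoly K[n]}) by rewrite -uu' msuppX inE.
  by rewrite msuppX inE => /eqP uE; exists u => //; rewrite uE.
have gen_in N v : generated_by_monomials I N -> N v -> I 'X_[v].
  by move=> NI Nv; apply/(NI _).2/ideal_span_gen; exists v.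
pose C := [seq w <- B | mdeg w == d].
(* [v] is a multiple of some [u] in [B], itself a multiple of some [t] in [M]; equal degrees force t
   = v, hence u = v. So the part of [B] in degree [d] already generates [I]. *)
have MC v : M v -> v \in C.
  move=> Mv; have [u uB uv] := dvd_gen _ _ BI (gen_in _ _ MI Mv).
  have [t Mt tu] := dvd_gen _ _ MI (gen_in _ _ BI uB).
  suff vu : v = u by rewrite mem_filter (dM _ Mv) eqxx vu.
  have tv : t = v by apply: lepm_mdeg_eq (lepm_trans tu uv) _; rewrite !dM.
  apply/mnmP => i; apply/anti_leq/andP; split; last exact: (mnm_lepP uv i).
  by rewrite -tv; apply: (mnm_lepP tu i).
have CB : {subset C <= B} by move=> v; rewrite mem_filter => /andP[].
suff CI : generated_by_monomials I (fun w => w \in C).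
  by move=> /(minB _ CB CI); rewrite mem_filter => /andP[/eqP].
move=> p; split=> [/(MI _).1|p_in].
  by apply: ideal_span_sub => g [v /MC Cv ->]; apply/ideal_span_gen; exists v.
apply/(BI _).2; apply: ideal_span_sub p_in => g [v /CB Bv ->].
by apply/ideal_span_gen; exists v.
Qed.

(** * The Rees ideal: binomials, fiber steps and linear steps *)

Section Rees.
Variables (K : fieldType) (n m : nat) (B : m.-tuple 'X_{1..n}).
Implicit Types (a b : 'X_{1..n}) (al be : 'X_{1..m}) (w : 'X_{1..n + m}).

(** Exponent of x^a T^al; [xpart] and [tpart] recover the two factors. *)
Definition jmon a al : 'X_{1..n + m} :=
  [multinom match split k with inl i => a i | inr i => al i end | k < n + m].

Definition xpart w : 'X_{1..n} := [multinom w (lshift m i) | i < n].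
Definition tpart w : 'X_{1..m} := [multinom w (rshift n i) | i < m].

Lemma jmon_lshift a al i : jmon a al (lshift m i) = a i.
Proof. by rewrite mnmE -[lshift m i]/(unsplit (inl i)) unsplitK. Qed.

Lemma jmon_rshift a al i : jmon a al (rshift n i) = al i.
Proof. by rewrite mnmE -[rshift n i]/(unsplit (inr i)) unsplitK. Qed.

Lemma jmonK w : jmon (xpart w) (tpart w) = w.
Proof.
apply/mnmP => k; rewrite mnmE; case: split_ordP => i ->; exact: mnmE.
Qed.

Lemma jmonD a b al be :
  jmon (a + b)%MM (al + be)%MM = (jmon a al + jmon b be)%MM.
Proof.
apply/mnmP => k; rewrite mnmDE !mnmE.
by case: (split k) => i; rewrite mnmDE.
Qed.

Lemma T_degree_jmon a al : T_degree (jmon a al) = mdeg al.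
Proof. by rewrite mdegE; apply: eq_bigr => i _; rewrite jmon_rshift. Qed.

Definition rees_var (k : 'I_(n + m)) : {poly {mpoly K[n]}} :=
  match split k with
  | inl i => ('X_i)%:P
  | inr i => ('X_[tnth B i])%:P * 'X
  end.

(** The composite form exhibits the coefficient map as a ring morphism, so that the whole map is
    one. *)
Lemma rees_mapE f : rees_map B f = mmap (polyC \o @mpolyC n K) rees_var f.
Proof. by []. Qed.

Lemma rees_mapX a al :
  rees_map B 'X_[jmon a al] = ('X_[a + bmon B al])%:P * 'X^(mdeg al)
  :> {poly {mpoly K[n]}}.
Proof.
rewrite rees_mapE mmapX /mmap1 big_split_ord /=.
rewrite (eq_bigr (fun i => ('X_i ^+ a i)%:P)) => [|i _]; last first.
  rewrite jmon_lshift /rees_var -[lshift m i]/(unsplit (inl i)) unsplitK.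
  by rewrite polyC_exp.
rewrite [X in _ * X](eq_bigr (fun i =>
    ('X_[tnth B i *+ al i])%:P * 'X ^+ al i)) => [|i _]; last first.
  rewrite jmon_rshift /rees_var -[rshift n i]/(unsplit (inr i)) unsplitK.
  by rewrite exprMn -polyC_exp mpolyXn.
rewrite big_split /= -!rmorph_prod -mpolyXE_id mulrA -polyCM.
rewrite -(big_morph _ (@mpolyXD _ _) (mpolyX0 _ _)) -mpolyXD.
by rewrite -(big_morph _ (exprD _) (expr0 _)) mdegE.
Qed.

Lemma rees_ideal_binomial a b al be :
  (a + bmon B al = b + bmon B be)%MM -> mdeg al = mdeg be ->
  rees_ideal B ('X_[jmon a al] - 'X_[jmon b be] : {mpoly K[n + m]}).
Proof.
move=> e de; rewrite /rees_ideal rees_mapE raddfB /= -!rees_mapE.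
by rewrite !rees_mapX e de subrr.
Qed.

(** The image of the term [w] in S[t]: its monomial in S and its power of t. *)
Definition rees_deg w := ((xpart w + bmon B (tpart w))%MM, mdeg (tpart w)).

(** As for the toric ideal, with the coefficient read off first at a power of t, then at a monomial
    of S. *)
Lemma rees_ideal_cancel (f : {mpoly K[n + m]}) w :
  rees_ideal B f -> w \in msupp f ->
  exists v, [/\ v \in msupp f, v != w & rees_deg v = rees_deg w].
Proof.
move=> f0 wf; have c_w : f@_w != 0 by rewrite -mcoeff_msupp.
have sum0 : \sum_(v <- msupp f) f@_v * (rees_deg v == rees_deg w)%:R = 0.
  rewrite -[RHS](mcoeff0 K (rees_deg w).1) -[X in X@__](coef0 _ (rees_deg w).2).
  rewrite -f0 rees_mapE /mmap coef_sum raddf_sum.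
  apply: eq_bigr => v _; rewrite /= coefCM mcoeffCM; congr (_ * _).
  have -> : mmap1 rees_var v =
      ('X_[(rees_deg v).1])%:P * 'X^((rees_deg v).2).
    by rewrite -rees_mapX jmonK rees_mapE mmapX.
  rewrite coefCM coefXn mulr_natr mcoeffMn mcoeffX -mulrnA mulnb; congr (_%:R).
  by rewrite [X in _ && X]eq_sym.
have [v [vf vw /eqP bv]] := cancelling_term
    (P := fun v => rees_deg v == rees_deg w) (msupp_uniq f) wf (eqxx _) c_w
    sum0.
by exists v.
Qed.

Local Notation linear_fiber_span := (ideal_span
  (fun g : {mpoly K[n + m]} => symmetric_relation B g \/ fiber_relation B g)).

Lemma T_inclusionX al :
  T_inclusion n 'X_[al] = 'X_[jmon 0%MM al] :> {mpoly K[n + m]}.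
Proof.
rewrite /T_inclusion mmapX /mmap1 [RHS]mpolyXE_id big_split_ord /=.
rewrite [X in _ = X * _]big1 ?mul1r => [|i _]; last first.
  by rewrite jmon_lshift mnm0E expr0.
by apply: eq_bigr => i _; rewrite jmon_rshift.
Qed.

(** Once x^a is factored out, the remaining binomial involves only T-variables. *)
Lemma fiber_step a al be :
  bmon B al = bmon B be -> mdeg al = mdeg be ->
  linear_fiber_span ('X_[jmon a al] - 'X_[jmon a be]).
Proof.
move=> e de; rewrite -[a]addm0 -[al]add0m -[be]add0m !jmonD !mpolyXD -mulrBr.
apply/ideal_spanMl/ideal_span_gen; right; split.
  by apply: rees_ideal_binomial; rewrite ?e.
exists ('X_[al] - 'X_[be]).
by rewrite /T_inclusion raddfB /= -!/(T_inclusion _ _) !T_inclusionX.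
Qed.

(** Once x^a T^al is factored out, x_q T_i - x_j T_k is left, a relation of T-degree 1. *)
Lemma linear_step a al q j i k :
  (U_(q) + tnth B i = U_(j) + tnth B k)%MM ->
  linear_fiber_span ('X_[jmon (a + U_(q)) (al + U_(i))]
                     - 'X_[jmon (a + U_(j)) (al + U_(k))]).
Proof.
move=> e; rewrite !jmonD !mpolyXD -mulrBr.
apply/ideal_spanMl/ideal_span_gen; left; split.
  by apply: rees_ideal_binomial; rewrite ?bmonU ?mdeg1.
move=> w /msuppB_le; rewrite mem_cat !msuppX !inE => /orP[] /eqP ->;
by rewrite T_degree_jmon mdeg1.
Qed.

(** Each term [w] of a relation [f] has a partner [v] of equal image. Subtracting f_w (X^w - X^v)
    removes [w] and creates no new term, so induction on the number of terms applies. *)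
Lemma rees_ideal_binomial_span (G : {mpoly K[n + m]} -> Prop) :
  (forall v w, rees_deg v = rees_deg w -> ideal_span G ('X_[v] - 'X_[w])) ->
  (forall g, G g -> rees_ideal B g) ->
  forall f, rees_ideal B f <-> ideal_span G f.
Proof.
move=> G_bin G_rees f; split; last first.
  exact: (ideal_span_kernel (f := mmap (polyC \o @mpolyC n K) rees_var)).
have [k le_k] := ubnP (size (msupp f)); elim: k f le_k => // k IH f le_k f0.
have [->|/eqP nz] := eqVneq f 0; first exact: ideal_span0.
have [w wf] : exists w, w \in msupp f.
  case E : (msupp f) nz => [|w s]; first by rewrite (msuppnil0 E).
  by exists w; rewrite inE eqxx.
have [v [vf vw e]] := rees_ideal_cancel f0 wf.
pose h := f@_w *: ('X_[w] - 'X_[v]) : {mpoly K[n + m]}.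
have hG : ideal_span G h by rewrite /h -mul_mpolyC; apply/ideal_spanMl/G_bin.
rewrite -[f](subrK h); apply: ideal_spanD => //; apply: IH.
  rewrite -ltnS; apply: leq_trans le_k; rewrite ltnS.
  rewrite (perm_size (perm_to_rem wf)) /= ltnS.
  apply: uniq_leq_size => // u; rewrite (mem_rem_uniq _ (msupp_uniq f)) !inE.
  rewrite !mcoeff_msupp /h mcoeffB mcoeffZ mcoeffB !mcoeffX.
  have [->|uw] := eqVneq u w; first by
    rewrite ?eqxx (negPf vw) subr0 mulr1 subrr eqxx.
  have [<-|uv] := eqVneq v u; first by rewrite -!mcoeff_msupp.
  by rewrite subrr mulr0 subr0.
have wv0 : rees_map B ('X_[w] - 'X_[v] : {mpoly K[n + m]}) = 0.
  have /= e1 := congr1 fst (esym e); have /= e2 := congr1 snd (esym e).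
  have := rees_ideal_binomial e1 e2.
  by rewrite !jmonK.
rewrite /rees_ideal rees_mapE raddfB /= -!rees_mapE f0 /h.
by rewrite rees_mapE mmapZ -rees_mapE wv0 mulr0 subrr.
Qed.

(** * Congruence of terms with equal image *)

Lemma standard_congruence (d N : nat) (lt_sharp : rel 'X_{1..m})
    (lt_sigma : rel 'X_{1..n}) :
  (0 < d)%N -> (forall w : 'X_{1..n}, w \in B -> mdeg w = d) ->
  monomial_order lt_sharp -> monomial_order lt_sigma ->
  sigma_exchange K B lt_sharp lt_sigma ->
  forall a al b be,
    standard_monomial lt_sharp (@toric_ideal K n m B) al ->
    standard_monomial lt_sharp (@toric_ideal K n m B) be ->
    mdeg al = N -> mdeg be = N -> (a + bmon B al = b + bmon B be)%MM ->
    linear_fiber_span ('X_[jmon a al] - 'X_[jmon b be]).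
Proof.
move=> d0 dB ord_sharp [irr tr tot _ ltD] exch.
(* The images climb in [lt_sigma], so the induction runs along the reversed order. *)
pose gt (v w : 'X_{1..n}) := lt_sigma w v.
have irr_gt : irreflexive gt by move=> w; apply: irr.
have tr_gt : transitive gt by move=> y x z xy yz; apply: tr yz xy.
(* The first term carries the smaller image [w]; [ideal_spanBC] swaps the terms when needed. *)
pose P (w : 'X_{1..n}) := forall a al b be,
    standard_monomial lt_sharp (@toric_ideal K n m B) al ->
    standard_monomial lt_sharp (@toric_ideal K n m B) be ->
    mdeg al = N -> mdeg be = N -> (a + bmon B al = b + bmon B be)%MM ->
    bmon B al = w -> w = bmon B be \/ lt_sigma w (bmon B be) ->
    linear_fiber_span ('X_[jmon a al] - 'X_[jmon b be]).
have dbmon al : mdeg al = N -> mdeg (bmon B al) = (d * N)%N.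
  by move=> <-; apply: mdeg_bmon.
suff Pw (w : 'X_{1..n}) : mdeg w = (d * N)%N -> P w.
  move=> a al b be sal sbe dal dbe e.
  have [eb|ne] := eqVneq (bmon B al) (bmon B be).
    by apply: (Pw (bmon B al)) => //; [exact: dbmon | left].
  case/orP: (tot _ _ ne) => lt_b.
    by apply: (Pw (bmon B al)) => //; [exact: dbmon | right].
  by apply/ideal_spanBC/(Pw (bmon B be)) => //; [exact: dbmon | right].
move: w; apply: (mdeg_eq_wf_ind irr_gt tr_gt) => w dw IH.
move=> a al b be sal sbe dal dbe e alw [wbe|lt_w].
  (* With equal images the x-parts agree by cancellation, the T-parts by uniqueness of standard
     monomials. *)
  move: e; rewrite alw wbe => /addIm ->.
  rewrite (standard_unique ord_sharp sal sbe) ?subrr ?alw //.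
  exact: ideal_span0.
have [u uE] := tmonP dal; have [v vE] := tmonP dbe.
have := exch N u v; rewrite uE vE -!bmon_tmon uE vE alw.
move=> /(_ sal sbe lt_w) [dl [q [j [_ j_u lt_q lt_jq /tnthP[k kE]]]]].
rewrite inE in j_u.
have [i iE] : exists i, u dl = i by eexists.
rewrite iE in j_u kE.
(* As x_j divides u_delta, the truncated subtraction in the exchange property is a true division. *)
have e_lin : (U_(q) + tnth B i = U_(j) + tnth B k)%MM.
  rewrite -kE addmC [in RHS]addmC submK //; last first.
    by rewrite lep1mP mnmDE -lt0n addn_gt0 j_u.
have [a' aE] : exists a', a = (a' + U_(q))%MM.
  exists (a - U_(q))%MM; rewrite submK // lep1mP -lt0n.
  by have /mnmP/(_ q) := e; rewrite !mnmDE alw; lia.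
have [al' alE] : exists al', al = (al' + U_(i))%MM.
  exists (al - U_(i))%MM; rewrite submK // lep1mP -uE -iE -lt0n.
  by rewrite mnm_sumE (bigD1 dl) //= mnm1E eqxx.
(* The exchanged T-monomial may fail to be standard; a standard one with the same image and degree
   replaces it. *)
have [ga [sga dga bga]] :=
  standard_exists K (al' + U_(k))%MM ord_sharp d0 dB.
have {}dga : mdeg ga = N by rewrite dga -dal alE !mdegD !mdeg1.
have b_shift : (U_(j) + bmon B ga = U_(q) + w)%MM.
  apply/mnmP => x; move/mnmP/(_ x): e_lin.
  by rewrite bga -alw alE !bmonD !bmonU !mnmDE; lia.
(* In monomials of S, x_j w < x_q w = x_j [bmon B ga]; the order being total, x_j can be
   cancelled. *)
have lt_wga : lt_sigma w (bmon B ga).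
  have lt_j : lt_sigma (U_(j) + w)%MM (U_(j) + bmon B ga)%MM.
    by rewrite b_shift ![(_ + w)%MM]addmC; apply: ltD.
  have [eq|ne] := eqVneq w (bmon B ga); first by rewrite -eq irr in lt_j.
  case/orP: (tot _ _ ne) => // /(ltD U_(j)%MM) /tr /(_ lt_j).
  by rewrite irr.
have e' : ((a' + U_(j)) + bmon B ga = b + bmon B be)%MM.
  by rewrite -addmA b_shift addmA -aE -e alw.
apply: ideal_spanB_trans
  (_ : linear_fiber_span (_ - 'X_[jmon (a' + U_(j)) ga])) _.
  rewrite {1}aE {1}alE; apply: ideal_spanB_trans (linear_step _ _ e_lin) _.
  by apply: fiber_step => //; rewrite dga -dal alE !mdegD !mdeg1.
(* Both images now exceed [w], by [lt_wga] and [lt_w], so the induction applies to the smaller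
   one. *)
have [eb|ne] := eqVneq (bmon B ga) (bmon B be).
  by apply: (IH (bmon B ga)) => //; [exact: dbmon | left].
case/orP: (tot _ _ ne) => lt_b.
  by apply: (IH (bmon B ga)) => //; [exact: dbmon | right].
by apply/ideal_spanBC/(IH (bmon B be)) => //; [exact: dbmon | right].
Qed.

Lemma rees_deg_congruence (d : nat) (lt_sharp : rel 'X_{1..m})
    (lt_sigma : rel 'X_{1..n}) :
  uniq B -> (forall w : 'X_{1..n}, w \in B -> mdeg w = d) ->
  monomial_order lt_sharp -> monomial_order lt_sigma ->
  sigma_exchange K B lt_sharp lt_sigma ->
  forall v w, rees_deg v = rees_deg w -> linear_fiber_span ('X_[v] - 'X_[w]).
Proof.
move=> uB dB ord_sharp ord_sigma exch v w e.
have /= e1 := congr1 fst e; have /= e2 := congr1 snd e.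
rewrite -[v]jmonK -[w]jmonK.
move: (xpart v) (xpart w) (tpart v) (tpart w) e1 e2 => {v w e} a b al be e1 e2.
(* For d = 0 there is at most one T-variable, and the toric ideal, which may
   contain T_1 - 1, no longer preserves the T-degree. *)
case: d dB => [|d] dB.
  have B0 i : tnth B i = 0%MM by apply/eqP; rewrite -mdeg_eq0 dB ?mem_tnth.
  have I1 (i j : 'I_m) : i = j by apply: (tuple_uniqP _ uB); rewrite !B0.
  have bmon0 ga : bmon B ga = 0%MM.
    by apply/mnmP => k; rewrite bmonE mnm0E big1 // => i _; rewrite B0 mnm0E.
  have eal : al = be.
    apply/mnmP => i; have mdeg_i ga : mdeg ga = ga i.
      rewrite mdegE (bigD1 i) //= big1 ?addn0 // => j.
      by rewrite (I1 j i) eqxx.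
    by rewrite -!mdeg_i.
  move: e1; rewrite !bmon0 !addm0 eal => ->; rewrite subrr.
  exact: ideal_span0.
(* For positive [d], fiber relations make both T-parts standard while keeping the x-parts, the
   images and the T-degrees. *)
have [al' [sal dal bal]] := standard_exists K al ord_sharp (ltn0Sn d) dB.
have [be' [sbe dbe bbe]] := standard_exists K be ord_sharp (ltn0Sn d) dB.
apply: (ideal_spanB_trans (fiber_step a (esym bal) (esym dal))).
apply: ideal_spanB_trans (fiber_step b bbe dbe).
apply: (standard_congruence (N := mdeg al) (ltn0Sn d) dB ord_sharp ord_sigma
  exch) => //.
  by rewrite dbe e2.
by rewrite bal bbe.
Qed.

End Rees.

(** * From congruent binomials to fiber type *)

Theorem corollary3p5 (K : fieldType) (n d m : nat)
    (I : {mpoly K[n]} -> Prop) (B : m.-tuple 'X_{1..n})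
    (lt_sharp : rel 'X_{1..m}) (lt_sigma : rel 'X_{1..n}) :
  monomial_ideal_in_degree d I ->
  minimal_monomial_generators I B ->
  monomial_order lt_sharp ->
  monomial_order lt_sigma ->
  sigma_exchange K B lt_sharp lt_sigma ->
  fiber_type K B.
Proof.
move=> I_d I_B ord_sharp ord_sigma exch.
have [uB _ _] := I_B.
apply: rees_ideal_binomial_span => [v w|g].
  have dB := minimal_generators_mdeg I_d I_B.
  exact: rees_deg_congruence uB dB ord_sharp ord_sigma exch v w.
(* Both kinds of generators lie in the Rees ideal by definition. *)
by case=> -[].
Qed.
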